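(* Let $0<a<1$ and let $b$ be an integer with $ab\ge1$. Let $I=[-1,1]$, let $W:I\times I\to\mathbb{R}$ be the kernel $W(x,y)=\sum_{n=0}^{\infty}a^n\cos(b^n\pi(x-y))$, and let $\mathcal{H}_W$ be the reproducing kernel Hilbert space on $I$ induced by $W$. Let $f\in\mathcal{H}_W$ have the series expansion $$f(x)=\sum_{n=0}^{\infty}a^{n/2}\left[c_n\cos(b^n\pi x)+d_n\sin(b^n\pi x)\right],\qquad x\in I,$$ with $(c_n),(d_n)\in\ell^2$. If $$\lim_{n\to\infty}c_n(a^{1/2}b)^n\neq0\quad\text{and}\quad\lim_{n\to\infty}d_n(a^{1/2}b)^n\neq0,\qquad( * )$$ then $f$ is nowhere differentiable. Moreover, if $H$ is the collection of all functions in $\mathcal{H}_W$ with an expansion of the form $\sum_{n=0}^{\infty}a^{n/2}\left[c_n\cos(b^n\pi x)+d_n\sin(b^n\pi x)\right]$, $x\in I$, with $(c_n),(d_n)\in\ell^2$ satisfying $( * )$, then $\overline{H}=\mathcal{H}_W$, the closure being taken with respect to the norm $\|\cdot\|_W$ of $\mathcal{H}_W$.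
   Context: $\ell^2$ is the space of square-summable real sequences indexed by $n\ge0$. The reproducing kernel Hilbert space induced by the symmetric positive definite kernel $W$ is the unique Hilbert space $\mathcal{H}_W$ of real-valued functions on $I$ such that $W(x,\cdot)\in\mathcal{H}_W$ and $f(x)=\langle f,W(x,\cdot)\rangle_W$ for all $x\in I$, $f\in\mathcal{H}_W$. Concretely, $\mathcal{H}_W$ is the set of functions $f(x)=\sum_{n=0}^{\infty}a^{n/2}[c_n\cos(b^n\pi x)+d_n\sin(b^n\pi x)]$ with $(c_n),(d_n)\in\ell^2$, with norm $\|f\|_W^2=\sum_{n=0}^\infty(c_n^2+d_n^2)$. The limits in $( * )$ are limits in the extended real line (the values $\pm\infty$ are allowed and count as nonzero). *)

(* Defs.v *)
From HB Require Import structures.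
From mathcomp Require Import all_boot all_order all_algebra.
From mathcomp Require Import all_classical all_reals all_analysis.

Set Implicit Arguments.
Unset Strict Implicit.
Unset Printing Implicit Defensive.

Import Order.TTheory GRing.Theory Num.Theory numFieldNormedType.Exports.

Local Open Scope classical_set_scope.
Local Open Scope ring_scope.

(* A Hilbert space of real functions on X is given by a complete normed space
   whose norm comes from an inner product, together with the map sending an
   element to the function on X that it is: linear and injective, so that
   elements of the space are identified with functions. *)
Record rkhs (R : realType) (X : Type) (K : X -> X -> R) := RKHS {
  rkhs_space :> completeNormedModType R;
  rkhs_dot : {dot rkhs_space for idfun};
  rkhs_normE : forall f, `|f| ^+ 2 = rkhs_dot f f;
  rkhs_fun : rkhs_space -> X -> R;
  rkhs_fun_scalar : forall x, scalar (rkhs_fun ^~ x);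
  rkhs_fun_inj : injective rkhs_fun;
  rkhs_kernel : X -> rkhs_space;
  rkhs_kernelE : forall x, rkhs_fun (rkhs_kernel x) = K x;
  rkhs_reproducing : forall f x, rkhs_fun f x = rkhs_dot f (rkhs_kernel x)
}.

Definition unitI (R : realType) : set R := `[-1, 1].
Arguments unitI : clear implicits.

(* The library's derivative is for functions defined around the point; here f
   lives on A only, so x^' is the punctured neighborhood filter of x in the
   subspace A (at the endpoints of an interval: one-sided derivatives). *)
Definition differentiable_at (R : realType) (A : set R) (f : A -> R) (x : A) :=
  cvg ((fun y : A => (f y - f x) / (set_val y - set_val x)) @ x^').

Definition nowhere_differentiable (R : realType) (A : set R) (f : A -> R) :=
  forall x : A, ~ differentiable_at f x.

Definition square_summable (R : realType) (u : R^nat) :=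
  cvgn (series (fun n => u n ^+ 2)).

(* The limit exists in the extended real line and is nonzero. *)
Definition nonzero_limit (R : realType) (u : R^nat) :=
  exists2 l : \bar R, l != 0%E & (u n)%:E @[n --> \oo] --> l.

Section Weierstrass.
Variables (R : realType) (a : R) (b : int).

Definition W (x y : unitI R) : R :=
  limn (series (fun n =>
    a ^+ n * cos (b%:~R ^+ n * pi * (set_val x - set_val y)))).

Definition has_expansion (f : unitI R -> R) (c d : R^nat) :=
  forall x : unitI R,
    series (fun n => a `^ (n%:R / 2) *
      (c n * cos (b%:~R ^+ n * pi * set_val x) +
       d n * sin (b%:~R ^+ n * pi * set_val x))) @ \oo --> f x.

Definition nonzero_limits (c d : R^nat) :=
  nonzero_limit (fun n => c n * (a `^ (1 / 2) * b%:~R) ^+ n) /\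
  nonzero_limit (fun n => d n * (a `^ (1 / 2) * b%:~R) ^+ n).

End Weierstrass.

(* Main.v *)
Require Import Defs.
From HB Require Import structures.
From mathcomp Require Import all_boot all_order all_algebra.
From mathcomp Require Import all_classical all_reals all_analysis.
From mathcomp Require Import ring lra zify.
Import Order.TTheory GRing.Theory Num.Theory numFieldNormedType.Exports.
Local Open Scope classical_set_scope.
Local Open Scope ring_scope.

(* Nowhere differentiability (Freud): with step [H = 2 / b ^ m] the second
   difference kills every term of index [n >= m] of a lacunary series
   [sum p_n cos (b^n pi x) + q_n sin (b^n pi x)], and iterating it makes the term
   of index [m - 1] dominate the others.  Evaluated at two points a quarter
   period of that term apart, a (one-sided) derivative at [x] bounds
   [r_n = b^n (|p_n| + |q_n|)] by [o(1)] plus a small geometric average of the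
   earlier [r_i], so [r_n] tends to 0, against the limit condition on [c].

   Density: averaging the kernel sections at [y + 2j / b^K], [j < b^K], removes
   exactly the frequencies [b^n], [n < K]; differences of consecutive averages
   are the waves [a^K cos (b^K pi (x - y))], which therefore lie in the space,
   are orthogonal for distinct [K], and are total because the averages tend to 0
   in norm.  So partial sums of the expansion converge to [f], and one may
   replace the tail of the coefficients by [(a^(1/2) b)^-n], which satisfies the
   limit condition. *)

(** * Trigonometric sums and second differences *)

Section Trigo.
Context {R : realType}.
Implicit Types (x y al be w H p q : R) (z : int).

Lemma cosD2piz x z : cos (x + z%:~R * (pi *+ 2)) = cos x.
Proof.
have P n y : cos (y + n%:R * (pi *+ 2)) = cos y.
  by rewrite mulr_natl; apply: periodicn; exact: cosD2pi.
case: z => n; first exact: P.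
by rewrite NegzE mulrNz mulNr -[in RHS](subrK (n.+1%:R * (pi *+ 2)) x) P.
Qed.

Lemma sinD2piz x z : sin (x + z%:~R * (pi *+ 2)) = sin x.
Proof. by rewrite -!cosBpihalf addrAC cosD2piz. Qed.

(** Multiplied by [2 * sin (be / 2)], each cosine becomes a difference of sines at the half steps
    around it, and the sum telescopes. *)
Lemma sum_cos_arith (M : nat) al be :
  2 * sin (be / 2) * (\sum_(j < M) cos (al + j%:R * be)) =
  sin (al + M%:R * be - be / 2) - sin (al - be / 2).
Proof.
elim: M => [|M IH]; first by rewrite big_ord0 mulr0 mul0r addr0 subrr.
rewrite big_ord_recr /= mulrDr IH.
have -> : al + M.+1%:R * be - be / 2 = (al + M%:R * be) + be / 2.
  by rewrite -natr1; field.
by rewrite (sinB (al + _)) (sinD (al + _)); ring.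
Qed.

(** The two end sines of the telescoped sum differ by whole turns, so they cancel. *)
Lemma sum_cos_roots_of_unity {M : nat} {z : int} al be :
  M%:R * be = z%:~R * (pi *+ 2) -> sin (be / 2) != 0 ->
  \sum_(j < M) cos (al + j%:R * be) = 0.
Proof.
move=> Mbe be0; have := sum_cos_arith M al be.
rewrite Mbe addrAC sinD2piz subrr => /eqP.
by rewrite !mulf_eq0 pnatr_eq0 /= (negPf be0) => /eqP.
Qed.

(** Waves of frequency [w] are eigenfunctions of this operator, with eigenvalue
    [2 * cos (w * H) - 2], and affine functions are in its kernel. *)
Definition diff2 H (u : R -> R) x := u (x + H) + u (x - H) - 2 * u x.

Lemma diff2_trig H w p q :
  diff2 H (fun x => p * cos (w * x) + q * sin (w * x)) =
  fun x => (2 * cos (w * H) - 2) * p * cos (w * x) +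
           (2 * cos (w * H) - 2) * q * sin (w * x).
Proof.
apply/funext => x; rewrite /diff2 !mulrDr mulrN !cosD !sinD !cosN !sinN; ring.
Qed.

Lemma iter_diff2_trig H w p q N :
  iter N (diff2 H) (fun x => p * cos (w * x) + q * sin (w * x)) =
  fun x => (2 * cos (w * H) - 2) ^+ N *
           (p * cos (w * x) + q * sin (w * x)).
Proof.
elim: N p q => [|N IH] p q; first by apply/funext => x /=; rewrite mul1r.
by rewrite iterSr diff2_trig IH; apply/funext => x; rewrite exprSr; ring.
Qed.

Lemma diff2_sum H (n : nat) (u : nat -> R -> R) :
  diff2 H (fun x => \sum_(i < n) u i x) =
  fun x => \sum_(i < n) diff2 H (u i) x.
Proof.
by apply/funext => x; rewrite /diff2 mulr_sumr -sumrN -!big_split.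
Qed.

Lemma iter_diff2_sum H N (n : nat) (u : nat -> R -> R) :
  iter N (diff2 H) (fun x => \sum_(i < n) u i x) =
  fun x => \sum_(i < n) iter N (diff2 H) (u i) x.
Proof.
by elim: N u => [//|N IH] u; rewrite iterSr diff2_sum (IH (fun i => diff2 H (u i)));
  apply/funext => x;
  apply: eq_bigr => i _; rewrite -iterSr.
Qed.

Lemma diff2_subr_affine H (u : R -> R) k l x0 :
  diff2 H (fun x => u x - k - l * (x - x0)) = diff2 H u.
Proof. by apply/funext => x; rewrite /diff2; ring. Qed.

Lemma cvg_iter_diff2 H N (u : nat -> R -> R) (v : R -> R) :
  (forall x, u n x @[n --> \oo] --> v x) ->
  forall x, iter N (diff2 H) (u n) x @[n --> \oo] --> iter N (diff2 H) v x.
Proof.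
elim: N u v => [//|N IH] u v uv x; under eq_cvg do rewrite iterSr.
rewrite iterSr; apply: (IH (fun n => diff2 H (u n))) => {}x.
by apply: cvgB; [apply: cvgD|apply: cvgMl_tmp].
Qed.

(** Each application reaches [H] further and multiplies a bound by at most [1 + 1 + 2]. *)
Lemma iter_diff2_le H N (u : R -> R) x (B : R) : 0 <= H ->
  (forall y, `|y - x| <= N%:R * H -> `|u y| <= B) ->
  `|iter N (diff2 H) u x| <= 4 ^+ N * B.
Proof.
move=> H0; elim: N u B => [|N IH] u B uB.
  by rewrite mul1r; apply: uB; rewrite subrr normr0 mul0r.
rewrite iterSr exprSr -mulrA; apply: IH => y yx.
have P t : `|t| <= H -> `|u (y + t)| <= B.
  move=> tH; apply: uB; rewrite addrAC (le_trans (ler_normD _ _))//.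
  by rewrite -natr1 mulrDl mul1r lerD.
have := P H; have := P (- H); have := P 0.
rewrite normrN normr0 addr0 (ger0_norm H0) H0 lexx => /(_ isT) B1 /(_ isT) B2 /(_ isT) B3.
apply: le_trans (ler_normD _ _) _; rewrite normrN normrM ger0_norm//.
by have := ler_normD (u (y + H)) (u (y - H)); lra.
Qed.

(** Since [2 * be / b <= be], it suffices to compare with [1 - cos be]; and [1 - cos (2 * be) = 2 *
    (1 - cos be) * (1 + cos be)] with [cos be >= 0]. *)
Lemma cos_double_gap be : 0 <= be <= pi / 2 -> forall b : nat, (2 <= b)%N ->
  2 * (1 - cos (2 * be / b%:R)) <= 1 - cos (2 * be).
Proof.
move=> /andP[be0 bepi] b b2.
have b0 : 2 <= b%:R :> R by rewrite ler_nat.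
have le1 : 2 * be / b%:R <= be.
  by rewrite ler_pdivrMr ?(lt_le_trans _ b0)// mulrC ler_wpM2l.
have pi0 := @pi_gt0 R.
have c1 : cos be <= cos (2 * be / b%:R).
  rewrite leNgt ltr_cos ?in_itv /=; first by rewrite -leNgt.
  - by apply/andP; split; lra.
  - apply/andP; split; last by lra.
    by apply: divr_ge0; lra.
have cge0 : 0 <= cos be by apply: cos_ge0_pihalf; apply/andP; split; lra.
have -> : cos (2 * be) = cos be ^+ 2 *+ 2 - 1 by rewrite -cos_mulr2n mulr_natl.
have := cos_le1 be; nra.
Qed.

Lemma wrap_unitI y : exists x : unitI R, exists z, set_val x = y + z%:~R * 2.
Proof.
have h : unitI R (y + (- Num.floor ((y + 1) / 2))%:~R * 2).
  have /andP[h1 h2] := floor_itv ((y + 1) / 2); rewrite /unitI /= in_itv /=.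
  rewrite intrD in h2; rewrite mulrNz.
  by apply/andP; split; lra.
by exists (SigSub (mem_set h)), (- Num.floor ((y + 1) / 2)).
Qed.

End Trigo.

(** * Recurrence inequalities that force convergence to zero *)

Section Recurrence.
Context {R : realType}.

Lemma half_recurrence_cvg0 (s : R^nat) : (forall n, 0 <= s n) ->
  (forall e, 0 < e -> exists n0, forall n, (n0 <= n)%N ->
     s n.+1 <= s n / 2 + e) ->
  s n @[n --> \oo] --> (0 : R).
Proof.
move=> s0 rec; apply/cvgrPdist_le => e e0.
have [n0 Hn0] := rec (e / 4) (divr_gt0 e0 (ltr0n _ 4)).
(* [e / 2] is the fixed point of [s |-> s / 2 + e / 4], which closes the induction. *)
have bnd k : s (n0 + k)%N <= s n0 / 2 ^+ k + e / 2.
  elim: k => [|k IH]; first by rewrite addn0 divr1; lra.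
  rewrite addnS (le_trans (Hn0 _ (leq_addr _ _)))// exprS invfM.
  by lra.
have : (s n0 * 2^-1 ^+ k : R) @[k --> \oo] --> 0.
  by rewrite -(mulr0 (s n0)); apply: cvgMl_tmp; apply: cvg_expr; rewrite ger0_norm; lra.
move=> /cvgrPdist_le /(_ (e / 2) (divr_gt0 e0 (ltr0n _ 2))) [k0 _ Hk0].
exists (n0 + k0)%N => // n /= nk; rewrite sub0r normrN ger0_norm//.
have n0n : (n0 <= n)%N by apply: leq_trans nk; exact: leq_addr.
have := Hk0 (n - n0)%N; rewrite /= leq_subRL// sub0r normrN => /(_ nk).
have := bnd (n - n0)%N; rewrite subnKC// -exprVn.
by have := ler_norm (s n0 * 2^-1 ^+ (n - n0)%N); lra.
Qed.

(** The weighted sum [s] satisfies [s n.+1 = (s n + r n) / 16], hence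
    [s n.+1 <= (5 * s n + e) / 16]: it contracts to 0 and carries [r] with it. *)
Lemma geometric_recurrence_cvg0 (r : R^nat) : (forall n, 0 <= r n) ->
  (forall e, 0 < e -> exists n0, forall n, (n0 <= n)%N ->
     r n <= e + 4 * \sum_(i < n) 16^-1 ^+ (n - i) * r i) ->
  r n @[n --> \oo] --> (0 : R).
Proof.
move=> r0 rec; pose s n := \sum_(i < n) 16^-1 ^+ (n - i) * r i.
have s0 n : 0 <= s n.
  by apply: sumr_ge0 => i _; rewrite mulr_ge0// exprn_ge0.
have sS n : s n.+1 = (s n + r n) / 16.
  rewrite /s big_ord_recr /= subSn// subnn expr1 mulrDl mulr_suml; congr (_ + _).
    by apply: eq_bigr => i _; rewrite subSn 1?ltnW// exprS; ring.
  by rewrite mulrC.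
have s_cvg : s n @[n --> \oo] --> (0 : R).
  apply: half_recurrence_cvg0 => // e e0; have [n0 Hn0] := rec e e0.
  exists n0 => n nn0; have := Hn0 n nn0; rewrite -/(s n) sS.
  by have := s0 n; lra.
apply/cvgrPdist_le => e e0.
have [n0 Hn0] := rec (e / 2) (divr_gt0 e0 (ltr0n _ 2)).
move/cvgrPdist_le : s_cvg => /(_ (e / 8) (divr_gt0 e0 (ltr0n _ 8))) [k0 _ Hk0].
exists (maxn n0 k0) => // n /=; rewrite geq_max => /andP[nn0 nk0].
have := Hk0 n nk0; rewrite /= !sub0r !normrN !ger0_norm//.
by have := Hn0 n nn0; rewrite -/(s n); lra.
Qed.

End Recurrence.

(** * Lacunary series *)

Section Lacunary.
Context {R : realType} {b : nat}.
Hypothesis b2 : (2 <= b)%N.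
Implicit Types (p q : R^nat) (y : R) (n m : nat).

Definition trig_term p q n y : R :=
  p n * cos (b%:R ^+ n * pi * y) + q n * sin (b%:R ^+ n * pi * y).

Let b_gt0 : 0 < b%:R :> R. Proof. by rewrite ltr0n; lia. Qed.
Let bX_gt0 n : 0 < b%:R ^+ n :> R. Proof. exact: exprn_gt0. Qed.
Let pi0 := @pi_gt0 R.

(** With step [2 / b ^ m], [diff2] multiplies the term of index [n <= m] by
    [- 2 * multiplier (m - n)]. *)
Definition multiplier k : R := 1 - cos (2 * pi / b%:R ^+ k).

Local Notation lam := multiplier.

Lemma multiplier_ge0 k : 0 <= lam k.
Proof. by rewrite subr_ge0 cos_le1. Qed.

Lemma multiplier1_gt0 : 0 < lam 1.
Proof.
rewrite subr_gt0 expr1 -[ltRHS]cos0.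
have b2' : 2 <= b%:R :> R by rewrite ler_nat.
have h : 0 < 2 * pi / b%:R :> R by apply: divr_gt0 => //; apply: mulr_gt0.
rewrite ltr_cos ?in_itv /= ?lexx ?(ltW pi0)// (ltW h) /=.
by rewrite ler_pdivrMr// mulrC ler_wpM2l// ltW.
Qed.

(** By [cos_double_gap] at [pi / b ^ j.+1], each further index at least halves the multiplier. *)
Lemma multiplier_geometric j : lam j.+1 <= lam 1 / 2 ^+ j.
Proof.
elim: j => [|j IH]; first by rewrite divr1.
have : 0 <= (pi : R) / b%:R ^+ j.+1 <= pi / 2.
  rewrite divr_ge0 ?(ltW pi0) ?(ltW (bX_gt0 _))//= ler_pM2l// lef_pV2 ?posrE//.
  rewrite exprS -natrX -natrM ler_nat (leq_trans b2)// leq_pmulr// expn_gt0.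
  by rewrite (leq_trans _ b2).
move=> /cos_double_gap /(_ b b2).
have -> : 2 * (pi / b%:R ^+ j.+1) / b%:R = 2 * pi / b%:R ^+ j.+2 :> R.
  by rewrite (exprSr _ j.+1); field; rewrite !gt_eqF.
rewrite mulrA -/(multiplier _) -/(multiplier _) => h.
rewrite exprS invfM; nra.
Qed.

(** For [n >= m] the step is a whole number of periods, so the eigenvalue is 0; the exponent [N.+1]
    is positive, so its power is 0 too. The partial sums are then constant from [m] on, and so equal
    the limit. *)
Lemma iter_diff2_lacunary p q (f : R -> R) N m y :
  (forall x, series (trig_term p q ^~ x) @ \oo --> f x) ->
  iter N.+1 (diff2 (2 / b%:R ^+ m)) f y =
  \sum_(n < m) (- 2 * lam (m - n)) ^+ N.+1 * trig_term p q n y.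
Proof.
move=> cf; set H := 2 / _.
have E M : iter N.+1 (diff2 H) (fun x => series (trig_term p q ^~ x) M) y =
   \sum_(i < M) (2 * cos (b%:R ^+ i * pi * H) - 2) ^+ N.+1 * trig_term p q i y.
  rewrite (_ : (fun x => _) = fun x => \sum_(i < M) trig_term p q i x); last first.
    by apply/funext => x; rewrite /series /= big_mkord.
  by rewrite iter_diff2_sum; apply: eq_bigr => i _; rewrite iter_diff2_trig.
have := @cvg_iter_diff2 R H N.+1 (fun M x => series (trig_term p q ^~ x) M) f cf y.
move=> /(cvg_unique (@Rhausdorff R)); apply.
apply: cvg_near_cst; exists m => // M; rewrite [X in X -> _]/= [LHS]E => mM.
rewrite -(subnKC mM) big_split_ord /= [X in _ + X]big1 ?addr0 => [|i _].
  apply: eq_bigr => i _; congr (_ ^+ _ * _); rewrite /lam /multiplier.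
  have -> : b%:R ^+ i * pi * H = 2 * pi / b%:R ^+ (m - i) :> R.
    rewrite /H -[in X in 2 / X](subnK (ltnW (ltn_ord i))) exprD.
    by field; rewrite !gt_eqF.
  ring.
have -> : b%:R ^+ (m + i) * pi * H = 0 + (b ^ i)%:Z%:~R * (pi *+ 2) :> R.
  by rewrite /H exprD -[_%:~R]/((b ^ i)%:R) natrX; field; rewrite gt_eqF.
by rewrite cosD2piz cos0 mulr1 subrr expr0n mul0r.
Qed.

(** Up to the factor [pi], a bound on the derivative of the term of index [n]. *)
Definition coef_size p q n : R := b%:R ^+ n * (`|p n| + `|q n|).

Lemma coef_size_ge0 p q n : 0 <= coef_size p q n.
Proof. by rewrite mulr_ge0 ?addr_ge0// ltW. Qed.

Lemma trig_term_le p q n y : `|trig_term p q n y| <= `|p n| + `|q n|.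
Proof.
rewrite (le_trans (ler_normD _ _))// !normrM.
by rewrite lerD// ler_piMr// ?cos_max ?sin_max.
Qed.

(* The multipliers decay geometrically away from frequency [m], so for [N]
   large the difference operator isolates the term of index [m]. *)
Lemma trig_term_isolated p q (f : R -> R) N m y (B : R) :
  (forall x, series (trig_term p q ^~ x) @ \oo --> f x) ->
  (16 * b <= 2 ^ N.+1)%N ->
  `|iter N.+1 (diff2 (2 / b%:R ^+ m.+1)) f y| <= B ->
  b%:R ^+ m * `|trig_term p q m y| <=
  b%:R ^+ m * B / (2 * lam 1) ^+ N.+1 +
  \sum_(n < m) 16^-1 ^+ (m - n) * coef_size p q n.
Proof.
move=> cf bN; rewrite (iter_diff2_lacunary _ _ _ _ _ _ cf) big_ord_recr /= subSn//.
rewrite subnn => hB.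
have lge0 k : 0 <= 2 * lam k by rewrite mulr_ge0 ?multiplier_ge0.
have l1 : 0 < 2 * lam 1 by rewrite mulr_gt0 ?multiplier1_gt0.
have L0 : 0 < (2 * lam 1) ^+ N.+1 by rewrite exprn_gt0.
have {hB} : (2 * lam 1) ^+ N.+1 * `|trig_term p q m y| <=
   B + \sum_(n < m) (2 * lam (m.+1 - n)) ^+ N.+1 * (`|p n| + `|q n|).
  have -> : (2 * lam 1) ^+ N.+1 * `|trig_term p q m y| =
     `|(- 2 * lam 1) ^+ N.+1 * trig_term p q m y|.
    by rewrite normrM normrX mulNr normrN (gtr0_norm l1).
  set S := \sum_(i < m) _ in hB.
  rewrite -[X in `|X|](addKr S) (le_trans (ler_normD _ _))// addrC normrN lerD//.
  apply: le_trans (ler_norm_sum _ _ _) _; apply: ler_sum => n _.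
  rewrite normrM normrX mulNr normrN (ger0_norm (lge0 _)).
  by rewrite ler_wpM2l ?trig_term_le// exprn_ge0.
move=> h; rewrite -(ler_pM2l L0) mulrCA; have := ler_wpM2l (ltW (bX_gt0 m)) h.
move=> /le_trans; apply; rewrite [leLHS]mulrDr [leRHS]mulrDr lerD//.
  by rewrite [leRHS]mulrC divfK ?gt_eqF.
rewrite !mulr_sumr; apply: ler_sum => n _; rewrite subSn ?(ltnW (ltn_ord n))//.
rewrite [in leRHS]/coef_size; set k := (m - n)%N.
have -> : b%:R ^+ m = b%:R ^+ k * b%:R ^+ n :> R by rewrite -exprD subnK// ltnW.
have -> : forall u v w x : R, u * v * (w * x) = (u * w) * (v * x).
  by move=> *; ring.
rewrite [leRHS]mulrA -/(coef_size p q n) ler_wpM2r ?coef_size_ge0//.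
(* The relative damping [2 ^ - (k * N.+1)] beats the frequency ratio [b ^ k]: since
   [16 * b <= 2 ^ N.+1], their product is at most [16 ^ - k]. *)
have : (2 * lam k.+1) ^+ N.+1 <= (2 * lam 1) ^+ N.+1 * (2^-1 ^+ N.+1) ^+ k.
  rewrite exprAC -exprMn lerXn2r ?nnegrE ?lge0//.
    by rewrite mulr_ge0 ?lge0 ?exprn_ge0.
  by rewrite -mulrA ler_wpM2l// exprVn multiplier_geometric.
move=> /(ler_wpM2l (ltW (bX_gt0 k))) /le_trans; apply.
rewrite mulrCA ler_pM2l// -exprMn lerXn2r ?nnegrE ?mulr_ge0 ?exprn_ge0 ?(ltW b_gt0)//.
rewrite exprVn ler_pdivrMr ?exprn_gt0// ler_pdivlMl//.
by rewrite -natrX -natrM ler_nat.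
Qed.


(** Up to sign, the two values are the coordinates of [(P, Q)] in a frame rotated by [t]; rotating
    back bounds each of [P] and [Q] by the sum of their absolute values. *)
Lemma quarter_turn_le (P Q t sg : R) : `|sg| = 1 ->
  `|P| + `|Q| <= 2 * (`|P * cos t + Q * sin t| +
    `|P * cos (t + sg * (pi / 2)) + Q * sin (t + sg * (pi / 2))|).
Proof.
move=> sg1.
have -> : P * cos (t + sg * (pi / 2)) + Q * sin (t + sg * (pi / 2)) =
          sg * (Q * cos t - P * sin t).
  have /orP[/eqP ->|/eqP ->] : (sg == 1) || (sg == -1).
    by have := eqr_norml sg 1; rewrite sg1 eqxx ler01 andbT => <-.
    by rewrite !mul1r cosDpihalf sinDpihalf; ring.
  by rewrite !mulN1r cosBpihalf sinBpihalf; ring.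
rewrite normrM sg1 mul1r.
set A := P * cos t + _; set B := Q * cos t - _.
have e := cos2Dsin2 t.
have hP : P = A * cos t - B * sin t.
  by rewrite -[LHS]mulr1 -e /A /B; ring.
have hQ : Q = A * sin t + B * cos t.
  by rewrite -[LHS]mulr1 -e /A /B; ring.
have bnd (u v x y : R) : `|x| <= 1 -> `|y| <= 1 -> `|u * x + v * y| <= `|u| + `|v|.
  move=> x1 y1; rewrite (le_trans (ler_normD _ _))// !normrM.
  by rewrite lerD// ler_piMr.
have hP' : `|P| <= `|A| + `|B|.
  by rewrite hP -mulrN bnd ?normrN ?cos_max ?sin_max.
have hQ' : `|Q| <= `|A| + `|B|.
  by rewrite hQ bnd ?cos_max ?sin_max.
lra.
Qed.

Lemma lacunary_coef_size_cvg0 p q (f : R -> R) x0 l sg : `|sg| = 1 ->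
  (forall x, series (trig_term p q ^~ x) @ \oo --> f x) ->
  (forall e, 0 < e -> exists2 d, 0 < d & forall t, 0 <= t <= d ->
     `|f (x0 + sg * t) - f x0 - l * (sg * t)| <= e * t) ->
  coef_size p q n @[n --> \oo] --> (0 : R).
Proof.
move=> sg1 cf df; apply: geometric_recurrence_cvg0 => [n|e e0].
  exact: coef_size_ge0.
pose N := (4 + b)%N.
have bN : (16 * b <= 2 ^ N.+1)%N.
  rewrite -addnS expnD leq_mul2l/= ltnW// (ltn_trans (ltnSn b))//.
  exact: ltn_expl.
set N' : R := N.+1%:R; have N'0 : 0 <= N' by [].
pose L := (2 * lam 1) ^+ N.+1.
have L0 : 0 < L by rewrite exprn_gt0// mulr_gt0 ?multiplier1_gt0.
(* [K] is the total amplification of the error of the linear approximation, so a relative error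
   [e / (4 * K)] contributes exactly [e / 4] (see [KE]). *)
pose K := 4 ^+ N.+1 * (2 * N' + 1) / L.
have K0 : 0 < K by rewrite divr_gt0// mulr_gt0 ?exprn_gt0//; lra.
have [d d0 Hd] := df (e / (4 * K)) (divr_gt0 e0 (mulr_gt0 (ltr0n _ 4) K0)).
(* From this rank on, the farthest distance [tau] from [x0] at which [f] is evaluated is at most
   [d]. *)
exists (Num.truncn ((2 * N' + 1) / d)).+1 => m hm.
have tau_le : (2 * N' + 1) / b%:R ^+ m <= d.
  rewrite ler_pdivrMr// [leRHS]mulrC -ler_pdivrMr// -natrX ltW//.
  apply: (lt_trans (truncnS_gt _)); rewrite ltr_nat (leq_ltn_trans hm)//.
  exact: ltn_expl.
set tau := _ / _ in tau_le.
set H : R := 2 / b%:R ^+ m.+1.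
have H0 : 0 <= H by rewrite divr_ge0// ltW.
have NH : N' * H <= N' / b%:R ^+ m.
  rewrite ler_wpM2l// /H exprS invfM mulrA ler_piMl ?invr_ge0 ?(ltW (bX_gt0 _))//.
  by rewrite ler_pdivrMr// mul1r ler_nat.
have sgE (u : R) : sg * (sg * u) = u.
  by rewrite mulrA -expr2 -real_normK ?num_real// sg1 expr1n mul1r.
(* The iterated difference reaches [N' * H] on both sides of its centre; [w >= N' * H] keeps all its
   points on the side [sg] of [x0], where the derivative gives control. *)
have bnd w : N' * H <= w <= N' * H + (2 * b%:R ^+ m)^-1 ->
    `|iter N.+1 (diff2 H) f (x0 + sg * w)| <= 4 ^+ N.+1 * (e / (4 * K) * tau).
  move=> /andP[w1 w2].
  (* Subtracting the tangent line leaves the differences unchanged and makes the function small. *)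
  rewrite iterSr -(diff2_subr_affine H f (f x0) l x0) -iterSr.
  apply: iter_diff2_le => // z hz.
  pose t := sg * (z - x0).
  have zE : z = x0 + sg * t by rewrite /t sgE; ring.
  have {hz} tw : `|t - w| <= N' * H.
    apply: le_trans hz; rewrite -(mul1r `|z - _|) -sg1 -normrM /t.
    by rewrite opprD addrA [in leRHS]mulrBr sgE.
  have /andP[t0 t1] : 0 <= t <= tau.
    move: tw; rewrite ler_norml => /andP[tw1 tw2].
    apply/andP; split; first lra.
    have : (2 * b%:R ^+ m)^-1 <= (b%:R ^+ m)^-1 :> R.
      by rewrite invfM ler_piMl ?invr_ge0 ?(ltW (bX_gt0 _))// invf_le1 ?ler1n.
    have -> : tau = 2 * (N' / b%:R ^+ m) + (b%:R ^+ m)^-1.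
      by rewrite /tau; field; rewrite gt_eqF.
    by lra.
  rewrite zE (addrC x0) addrK -(addrC x0).
  apply: le_trans (Hd t _) _; first by rewrite t0 (le_trans t1).
  by rewrite ler_wpM2l// ltW// divr_gt0// mulr_gt0.
set S := \sum_(i < m) _.
have KE : b%:R ^+ m * (4 ^+ N.+1 * (e / (4 * K) * tau)) / L = e / 4.
  rewrite /tau /K; field; apply/and4P; split; rewrite gt_eqF ?exprn_gt0//.
  by rewrite mulr_gt0 ?multiplier1_gt0.
have i0 : 0 <= (2 * b%:R ^+ m)^-1 :> R by rewrite invr_ge0 mulr_ge0// ltW.
have T w : N' * H <= w <= N' * H + (2 * b%:R ^+ m)^-1 ->
    b%:R ^+ m * `|trig_term p q m (x0 + sg * w)| <= e / 4 + S.
  move=> /bnd /(trig_term_isolated _ _ _ _ _ _ _ cf bN); rewrite -/L KE.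
  exact.
(* The two ends of the range of [w] are [1 / (2 * b ^ m)] apart, a quarter period of the term [m].
   Two bounds [e / 4 + S], doubled by [quarter_turn_le], give [e + 4 * S]. *)
have := T (N' * H); rewrite lexx lerDl i0 => /(_ isT) T1.
have := T (N' * H + (2 * b%:R ^+ m)^-1); rewrite lexx lerDl i0 => /(_ isT) T2.
have := quarter_turn_le (p m) (q m) (b%:R ^+ m * pi * (x0 + sg * (N' * H))) _ sg1.
have -> : b%:R ^+ m * pi * (x0 + sg * (N' * H)) + sg * (pi / 2) =
   b%:R ^+ m * pi * (x0 + sg * (N' * H + (2 * b%:R ^+ m)^-1)).
  by field; rewrite gt_eqF.
move=> /(ler_wpM2l (ltW (bX_gt0 m))); rewrite -/(coef_size p q m).
rewrite -/(trig_term p q m _) -/(trig_term p q m _).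
by rewrite mulrCA mulrDr; lra.
Qed.

End Lacunary.

(** * From the interval to the line: periodic extension and one-sided derivatives *)

Section LacunaryDifferentiable.
Context {R : realType} {b : nat}.
Hypothesis b2 : (2 <= b)%N.

Lemma trig_term_periodic (p q : R^nat) n (y : R) (z : int) :
  trig_term (b := b) p q n (y + z%:~R * 2) = trig_term (b := b) p q n y.
Proof.
rewrite /trig_term.
have -> : b%:R ^+ n * pi * (y + z%:~R * 2) =
    b%:R ^+ n * pi * y + ((b ^ n)%:Z * z)%:~R * (pi *+ 2) :> R.
  by rewrite intrM -[(b ^ n)%:Z%:~R]/((b ^ n)%:R) natrX; ring.
by rewrite cosD2piz sinD2piz.
Qed.

(** All terms have period 2, the length of the interval, so convergence there gives convergence on
    the whole line. *)
Lemma cvg_trig_series_periodic (p q : R^nat) (f : unitI R -> R) :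
  (forall x : unitI R,
     series (trig_term (b := b) p q ^~ (set_val x)) @ \oo --> f x) ->
  exists2 g : R -> R, (forall x : unitI R, g (set_val x) = f x) &
    forall y, series (trig_term (b := b) p q ^~ y) @ \oo --> g y.
Proof.
move=> cf; exists (fun y => limn (series (trig_term (b := b) p q ^~ y))).
  by move=> x; apply/cvg_lim => //; exact: cf.
move=> y; have [x [z xE]] := wrap_unitI y; have := cf x; rewrite xE.
rewrite (_ : (trig_term p q ^~ _) = trig_term (b := b) p q ^~ y); last first.
  by apply/funext => n; rewrite trig_term_periodic.
by move=> h; apply/cvg_ex; exists (f x).
Qed.

Lemma differentiable_at_one_sided (f : unitI R -> R) (x0 : unitI R) :
  differentiable_at f x0 -> exists l sg : R, `|sg| = 1 /\
  forall e, 0 < e -> exists2 d, 0 < d & forall t, 0 <= t <= d ->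
    exists2 x : unitI R, set_val x = set_val x0 + sg * t &
      `|f x - f x0 - l * (sg * t)| <= e * t.
Proof.
(* Going towards the farther endpoint leaves room at least 1 inside the interval, even when [x0] is
   an endpoint. *)
move=> /cvg_ex[/= l fl]; pose sg : R := if set_val x0 <= 0 then 1 else -1.
have sg1 : `|sg| = 1 by rewrite /sg; case: ifP; rewrite ?normrN normr1.
exists l, sg; split=> // e e0.
have room t : 0 <= t <= 1 -> [set` `[-1, 1]] (set_val x0 + sg * t).
  have : -1 <= set_val x0 <= 1 by have := set_valP x0; rewrite /unitI /= in_itv.
  move=> /andP[h1 h2] /andP[t0 t1]; rewrite /= in_itv /= /sg.
  by case: (lerP (set_val x0) 0) => h; apply/andP; split; lra.
move/cvgrPdist_le : fl => /(_ e e0) [_ [[U oU <-] Ux0 sU]].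
move: oU; rewrite openE => /(_ _ Ux0) /nbhs_ballP[r /= r0 rU].
exists (Num.min 1 (r / 2)); first by rewrite lt_min ltr01 divr_gt0.
move=> t /andP[t0]; rewrite le_min => /andP[t1 tr].
have ht : 0 <= t <= 1 by rewrite t0.
exists (SigSub (mem_set (room t ht))); first by [].
set x := SigSub _; have xE : set_val x = set_val x0 + sg * t by [].
have [t_eq0|t_neq0] := eqVneq t 0.
  have -> : x = x0 by apply/val_inj/(etrans xE); rewrite t_eq0 mulr0 addr0.
  by rewrite t_eq0 !mulr0 subrr subr0 normr0.
have st0 : sg * t != 0 by rewrite -normr_eq0 normrM sg1 mul1r normr_eq0.
have dx : set_val x - set_val x0 = sg * t by rewrite xE; ring.
have P : U (set_val x) -> x != x0 ->
    `|l - (f x - f x0) / (set_val x - set_val x0)| <= e by exact: sU.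
rewrite dx in P.
have {P} : `|l - (f x - f x0) / (sg * t)| <= e.
  apply: P; last by apply: contra_neq st0 => xx0; have := xE; rewrite xx0; lra.
  apply: rU; rewrite /ball /= xE opprD addrA subrr sub0r normrN normrM sg1.
  by rewrite mul1r ger0_norm// (le_lt_trans tr)// ltr_pdivrMr// ltr_pMr// ltr1n.
move=> /(ler_wpM2r t0); apply: le_trans.
have tE : `|sg * t| = t by rewrite normrM sg1 mul1r ger0_norm.
by rewrite -[X in _ <= _ * X]tE -normrM distrC mulrBl divfK.
Qed.

(* Freud's theorem on lacunary trigonometric series. *)
Lemma lacunary_differentiable_coef_cvg0 (p q : R^nat) (f : unitI R -> R) x0 :
  (forall x : unitI R,
     series (trig_term (b := b) p q ^~ (set_val x)) @ \oo --> f x) ->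
  differentiable_at f x0 -> coef_size (b := b) p q n @[n --> \oo] --> (0 : R).
Proof.
move=> /cvg_trig_series_periodic[g gf cg] /differentiable_at_one_sided.
move=> [l [sg [sg1 df]]].
apply: (lacunary_coef_size_cvg0 b2 p q g (set_val x0) l sg) => // e e0.
have [d d0 Hd] := df e e0; exists d => // t /Hd[x <-].
by rewrite !gf.
Qed.

End LacunaryDifferentiable.

(** * Reproducing kernel Hilbert spaces *)

Section RKHS.
Context {R : realType} {X : Type} {K : X -> X -> R} {HW : rkhs K}.
Implicit Types (f g h : HW) (t : R).

Definition dot f g : R := rkhs_dot HW f g.

Lemma dotC f g : dot f g = dot g f.
Proof.
by rewrite /dot (@hermitian_subproof _ _ _ _ (rkhs_dot HW)) expr0 mul1r.
Qed.

Lemma dotDl f g h : dot (f + g) h = dot f h + dot g h.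
Proof. exact: linearDl. Qed.

Lemma dotZl t f g : dot (t *: f) g = t * dot f g.
Proof. exact: linearZl_LR. Qed.

Lemma dotBl f g h : dot (f - g) h = dot f h - dot g h.
Proof. exact: linearBl. Qed.

Lemma dotDr f g h : dot h (f + g) = dot h f + dot h g.
Proof. by rewrite dotC dotDl !(dotC h). Qed.

Lemma dotZr t f g : dot f (t *: g) = t * dot f g.
Proof. by rewrite dotC dotZl dotC. Qed.

Lemma dotBr f g h : dot h (f - g) = dot h f - dot h g.
Proof. by rewrite dotC dotBl !(dotC h). Qed.

Lemma dot0l f : dot 0 f = 0.
Proof. by rewrite -(subrr f) dotBl subrr. Qed.

Lemma dot_suml (I : Type) (r : seq I) (P : pred I) (F : I -> HW) g :
  dot (\sum_(i <- r | P i) F i) g = \sum_(i <- r | P i) dot (F i) g.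
Proof. exact: linear_sumlz. Qed.

Lemma normE f : `|f| ^+ 2 = dot f f.
Proof. exact: rkhs_normE. Qed.

Lemma dot_ge0 f : 0 <= dot f f.
Proof. by rewrite -normE sqr_ge0. Qed.

Lemma cauchy_schwarz f g : `|dot f g| <= `|f| * `|g|.
Proof.
have [->|g0] := eqVneq g 0; first by rewrite dotC dot0l !normr0 mulr0.
rewrite -(@ler_pXn2r _ 2%N) ?nnegrE ?mulr_ge0//.
rewrite exprMn !normE real_normK ?num_real//.
have gg : 0 < dot g g by rewrite -normE exprn_gt0// normr_gt0.
have := dot_ge0 (dot g g *: f - dot f g *: g).
have -> : dot (dot g g *: f - dot f g *: g) (dot g g *: f - dot f g *: g) =
    dot g g * (dot f f * dot g g - dot f g ^+ 2).
  by rewrite !(dotBl, dotBr, dotZl, dotZr) (dotC g f); ring.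
by rewrite pmulr_rge0// subr_ge0.
Qed.

Lemma cvg_dotl (u : nat -> HW) f g :
  u n @[n --> \oo] --> f -> dot (u n) g @[n --> \oo] --> dot f g.
Proof.
move=> /cvgr_dist_le uf; apply/cvgrPdist_le => e e0.
have d0 : 0 < e / (`|g| + 1) by rewrite divr_gt0// ltr_wpDl.
near=> n; rewrite -dotBl (le_trans (cauchy_schwarz _ _))//.
have un : `|f - u n| <= e / (`|g| + 1) by near: n; exact: uf.
apply: le_trans (ler_wpM2r (normr_ge0 g) un) _.
rewrite mulrAC ler_pdivrMr ?ltr_wpDl// ler_wpM2l ?(ltW e0)//.
by rewrite lerDl.
Unshelve. all: by end_near. Qed.

Lemma rkhs_funE f x : rkhs_fun f x = dot f (rkhs_kernel HW x).
Proof. exact: rkhs_reproducing. Qed.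

Lemma cvg_rkhs_fun (u : nat -> HW) f x : u n @[n --> \oo] --> f ->
  rkhs_fun (u n) x @[n --> \oo] --> rkhs_fun f x.
Proof.
move=> uf; under eq_cvg do rewrite rkhs_funE.
by rewrite rkhs_funE; exact: cvg_dotl.
Qed.

Lemma rkhs_funD f g x : rkhs_fun (f + g) x = rkhs_fun f x + rkhs_fun g x.
Proof. by rewrite !rkhs_funE dotDl. Qed.

Lemma rkhs_funB f g x : rkhs_fun (f - g) x = rkhs_fun f x - rkhs_fun g x.
Proof. by rewrite !rkhs_funE dotBl. Qed.

Lemma rkhs_funZ t f x : rkhs_fun (t *: f) x = t * rkhs_fun f x.
Proof. by rewrite !rkhs_funE dotZl. Qed.

Lemma rkhs_fun_sum (I : Type) (r : seq I) (P : pred I) (F : I -> HW) x :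
  rkhs_fun (\sum_(i <- r | P i) F i) x = \sum_(i <- r | P i) rkhs_fun (F i) x.
Proof.
by rewrite rkhs_funE dot_suml; apply: eq_bigr => i _; rewrite rkhs_funE.
Qed.

End RKHS.

(** * Nowhere differentiability from the limit condition *)

Section Expansion.
Context {R : realType} {a : R} {b : nat}.
Hypotheses (a_gt0 : 0 < a) (b2 : (2 <= b)%N).

Lemma powR_half_nat n : a `^ (n%:R / 2) = (a `^ (1 / 2)) ^+ n.
Proof. by rewrite -powR_mulrn ?powR_ge0// -powRrM mul1r mulrC. Qed.

Lemma has_expansion_trig_term (f : unitI R -> R) c d :
  has_expansion a b f c d -> forall x : unitI R,
  series (trig_term (b := b) (fun n => a `^ (n%:R / 2) * c n)
    (fun n => a `^ (n%:R / 2) * d n) ^~ (set_val x)) @ \oo --> f x.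
Proof.
move=> cf x; set u := (X in series X); suff -> : u = fun n => a `^ (n%:R / 2) *
    (c n * cos (b%:R ^+ n * pi * set_val x) +
     d n * sin (b%:R ^+ n * pi * set_val x)) by exact: cf.
by apply/funext => n; rewrite /u /trig_term /= [RHS]mulrDr !mulrA.
Qed.

(** A derivative at one point makes [coef_size] tend to 0; it dominates the absolute value of
    [c n * (a ^ (1/2) * b) ^ n], whose limit would then be 0. *)
Lemma nonzero_limits_nowhere_differentiable (f : unitI R -> R) c d :
  has_expansion a b f c d -> nonzero_limits a b c d -> nowhere_differentiable f.
Proof.
move=> /has_expansion_trig_term cf [[l l0 cl] _] x.
move=> /(lacunary_differentiable_coef_cvg0 b2 _ _ _ _ cf) cvg0.
have c0 : c n * (a `^ (1 / 2) * b%:R) ^+ n @[n --> \oo] --> (0 : R).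
  apply/norm_cvg0P; apply: (squeeze_cvgr _ (cvg_cst 0) cvg0).
  apply: nearW => n; rewrite normr_ge0 /= /coef_size.
  rewrite powR_half_nat exprMn !normrM (ger0_norm (exprn_ge0 _ (ler0n _ _))).
  by rewrite mulrC -mulrA mulrCA ler_wpM2l ?exprn_ge0// mulrC lerDl.
have c0' : (c n * (a `^ (1 / 2) * b%:R) ^+ n)%:E @[n --> \oo] --> 0%E.
  by apply: cvg_EFin => //; exact: nearW.
by move: l0; rewrite (cvg_unique (@ereal_hausdorff R) cl c0') eqxx.
Qed.
End Expansion.

Lemma cvgn_sum {R : realType} (I : Type) (r : seq I) (u : I -> R^nat) (l : I -> R) :
  (forall i, u i @ \oo --> l i) ->
  \sum_(i <- r) u i n @[n --> \oo] --> \sum_(i <- r) l i.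
Proof.
move=> ul; elim: r => [|i r IH].
  by rewrite big_nil; under eq_cvg do rewrite big_nil; exact: cvg_cst.
by rewrite big_cons; under eq_cvg do rewrite big_cons; exact: cvgD.
Qed.

(** * The Weierstrass kernel and its space *)

Section AverageCos.
Context {R : realType} {b : nat}.
Hypothesis b2 : (2 <= b)%N.
Implicit Types (s : R) (K n : nat).

Let b_gt0 : 0 < b%:R :> R. Proof. by rewrite ltr0n; lia. Qed.
Let bX_gt0 n : 0 < b%:R ^+ n :> R. Proof. exact: exprn_gt0. Qed.
Let pi0 := @pi_gt0 R.

(** For [n < K] the angles are equally spaced over whole turns and cancel; for [n >= K] each
    translation is by a multiple of the period. *)
Lemma avg_cos K n s : (b%:R ^+ K)^-1 *
    (\sum_(j < b ^ K) cos (b%:R ^+ n * pi * (s + j%:R * (2 / b%:R ^+ K)))) =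
  if (n < K)%N then 0 else cos (b%:R ^+ n * pi * s).
Proof.
case: ifPn => [nK|].
  rewrite (_ : \sum_(_ < _) _ = 0) ?mulr0//.
  under eq_bigr do rewrite mulrDr mulrCA.
  apply: (@sum_cos_roots_of_unity _ _ (b ^ n)%:Z).
    by rewrite -[_%:~R]/((b ^ n)%:R) !natrX; field; rewrite gt_eqF.
  have -> : b%:R ^+ n * pi * (2 / b%:R ^+ K) / 2 = pi / b%:R ^+ (K - n) :> R.
    rewrite -[in X in 2 / X](subnK (ltnW nK)) exprD.
    by field; rewrite !gt_eqF.
  rewrite gt_eqF// sin_gt0_pi// divr_gt0//= ltr_pdivrMr// ltr_pMr//.
  by rewrite exprn_egt1 ?ltr1n// -lt0n subn_gt0.
rewrite -leqNgt => Kn.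
rewrite (eq_bigr (fun=> cos (b%:R ^+ n * pi * s))) => [|j _].
  by rewrite sumr_const card_ord -(mulr_natl (cos _)) natrX mulKf// gt_eqF.
have -> : b%:R ^+ n * pi * (s + j%:R * (2 / b%:R ^+ K)) =
    b%:R ^+ n * pi * s + (j * b ^ (n - K))%:Z%:~R * (pi *+ 2) :> R.
  have -> : (j * b ^ (n - K))%:Z%:~R = j%:R * b%:R ^+ (n - K) :> R.
    by rewrite -natrX -natrM.
  rewrite mulrDr -[in X in _ + X = _](subnK Kn) exprD; congr (_ + _).
  by field; rewrite gt_eqF.
by rewrite cosD2piz.
Qed.

End AverageCos.

Section WeierstrassKernel.
Context {R : realType} {a : R} {b : nat}.
Hypotheses (a_gt0 : 0 < a) (a_lt1 : a < 1) (b2 : (2 <= b)%N).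
Implicit Types (s y : R) (K n : nat).

Definition W_term s n := a ^+ n * cos (b%:R ^+ n * pi * s).

(** The kernel as a function of [x - y], taken on the whole line so that averaging points may leave
    the interval. *)
Definition W_fun s : R := limn (series (W_term s)).

Lemma W_term_le s n : `|W_term s n| <= a ^+ n.
Proof.
by rewrite normrM ger0_norm ?exprn_ge0 ?(ltW a_gt0)// ler_piMr ?cos_max// exprn_ge0 ?ltW.
Qed.

Lemma cvg_W_fun s : series (W_term s) @ \oo --> W_fun s.
Proof.
apply: (@normed_cvg _ R^o); apply: (@series_le_cvg _ _ (geometric 1 a)).
- by move=> n; exact: normr_ge0.
- by move=> n; rewrite /= mul1r exprn_ge0// ltW.
- by move=> n; rewrite /= mul1r W_term_le.
- by apply: is_cvg_geometric_series; rewrite ger0_norm// ltW.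
Qed.

Lemma W_term_periodic s (z : int) : W_term (s + z%:~R * 2) = W_term s.
Proof.
apply/funext => n; have := trig_term_periodic (b := b) (fun n => a ^+ n) (cst 0) n s z.
by rewrite /trig_term /cst !mul0r !addr0.
Qed.

Lemma W_fun_periodic s (z : int) : W_fun (s + z%:~R * 2) = W_fun s.
Proof. by rewrite /W_fun W_term_periodic. Qed.

Definition W_tail K s := W_fun s - \sum_(n < K) W_term s n.

Lemma W_tailS K s : W_tail K s - W_tail K.+1 s = W_term s K.
Proof. by rewrite /W_tail big_ord_recr /=; ring. Qed.

Lemma cvg_W_tail K s :
  (\sum_(K <= n < N) W_term s n) @[N --> \oo] --> W_tail K s.
Proof.
have h : (fun N => series (W_term s) N - \sum_(n < K) W_term s n) @ \oo -->
    W_tail K s by apply: cvgB; [exact: cvg_W_fun|exact: cvg_cst].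
apply: cvg_trans h; apply: near_eq_cvg; exists K => // N /= KN.
by rewrite /series /= (big_cat_nat (leq0n K) KN)//= big_mkord addrAC subrr add0r.
Qed.

(** At 0 every cosine is 1, so each term attains its bound [a ^ n]. *)
Lemma W_tail_le K s : `|W_tail K s| <= W_tail K 0.
Proof.
apply: (ler_cvg_to (cvg_norm (cvg_W_tail K s)) (cvg_W_tail K 0)).
apply: nearW => N; rewrite (le_trans (ler_norm_sum _ _ _))//.
apply: ler_sum => n _.
by rewrite [leRHS]/W_term mulr0 cos0 mulr1 W_term_le.
Qed.

Lemma W_tail0_cvg0 : W_tail ^~ 0 @ \oo --> (0 : R).
Proof.
suff : W_tail ^~ 0 @ \oo --> W_fun 0 - W_fun 0 by rewrite subrr.
apply: cvgB; first exact: cvg_cst.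
rewrite (_ : (fun K => _) = series (W_term 0)); first exact: cvg_W_fun.
by apply/funext => K; rewrite /series /= big_mkord.
Qed.

Lemma avg_W K s : (b%:R ^+ K)^-1 *
    (\sum_(j < b ^ K) W_fun (s + j%:R * (2 / b%:R ^+ K))) = W_tail K s.
Proof.
have c1 : ((b%:R ^+ K)^-1 * (\sum_(j < b ^ K)
    series (W_term (s + j%:R * (2 / b%:R ^+ K))) N)) @[N --> \oo] -->
  (b%:R ^+ K)^-1 * (\sum_(j < b ^ K) W_fun (s + j%:R * (2 / b%:R ^+ K))).
  by apply: cvgMl_tmp; apply: cvgn_sum => j; exact: cvg_W_fun.
apply: (cvg_unique (@Rhausdorff R) c1).
apply: cvg_trans (cvg_W_tail K s); apply: near_eq_cvg.
exists K => // N /= KN.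
rewrite /series /= exchange_big /= mulr_sumr (big_cat_nat (leq0n K) KN)//=.
rewrite [X in _ = X + _]big1_seq ?add0r => [|n].
  apply: eq_big_nat => n /andP[Kn _].
  by rewrite /W_term -mulr_sumr mulrCA (avg_cos b2) ltnNge Kn.
rewrite mem_index_iota => /andP[_ /andP[_ nK]].
by rewrite /W_term -mulr_sumr mulrCA (avg_cos b2) nK mulr0.
Qed.

Definition wrap_pt y : unitI R := projT1 (cid (wrap_unitI y)).

Lemma wrap_ptE y : exists z : int, set_val (wrap_pt y) = y + z%:~R * 2.
Proof. exact: projT2 (cid (wrap_unitI y)). Qed.

End WeierstrassKernel.

(** * An orthonormal basis of waves *)

Section WeierstrassSpace.
Context {R : realType} {a : R} {b : nat}.
Hypotheses (a_gt0 : 0 < a) (a_lt1 : a < 1) (b2 : (2 <= b)%N).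
Context (HW : rkhs (W a b)).
Implicit Types (x : unitI R) (y z : R) (K n m N : nat) (f g : HW) (c d : R^nat).

Let b_gt0 : 0 < b%:R :> R. Proof. by rewrite ltr0n; lia. Qed.
Let bX_gt0 n : 0 < b%:R ^+ n :> R. Proof. exact: exprn_gt0. Qed.

Let sa := a `^ (1 / 2).
Let sa_gt0 : 0 < sa. Proof. exact: powR_gt0. Qed.
Let saX_gt0 n : 0 < sa ^+ n. Proof. exact: exprn_gt0. Qed.
Let saE n : sa ^+ n * sa ^+ n = a ^+ n.
Proof.
rewrite -exprMn -expr2 /sa -[X in X ^+ n]powR_mulrn ?powR_ge0// -powRrM.
by rewrite mul1r mulVf// powRr1// ltW.
Qed.

Local Notation Wterm := (W_term (a := a) (b := b)).
Local Notation Wtail := (W_tail (a := a) (b := b)).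

Lemma W_termN s n : Wterm (- s) n = Wterm s n.
Proof. by rewrite /W_term mulrN cosN. Qed.

Definition kernel_elt y : HW := rkhs_kernel HW (wrap_pt y).

Lemma kernel_eltE y x :
  rkhs_fun (kernel_elt y) x = W_fun (a := a) (b := b) (y - set_val x).
Proof.
rewrite /kernel_elt rkhs_kernelE; have [z zE] := wrap_ptE y.
by rewrite -[RHS](W_fun_periodic _ z) addrAC -zE.
Qed.

Lemma dot_kernel_elt f y : dot f (kernel_elt y) = rkhs_fun f (wrap_pt y).
Proof. by rewrite rkhs_funE. Qed.

Definition tail_elt K y : HW :=
  (b%:R ^+ K)^-1 *: \sum_(j < b ^ K) kernel_elt (y + j%:R * (2 / b%:R ^+ K)).

Lemma tail_eltE K y x : rkhs_fun (tail_elt K y) x = Wtail K (y - set_val x).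
Proof.
rewrite rkhs_funZ rkhs_fun_sum -avg_W//; congr (_ * _).
by apply: eq_bigr => j _; rewrite kernel_eltE addrAC.
Qed.

Lemma dot_tail_elt f K y : dot f (tail_elt K y) =
  (b%:R ^+ K)^-1 *
    (\sum_(j < b ^ K) rkhs_fun f (wrap_pt (y + j%:R * (2 / b%:R ^+ K)))).
Proof.
rewrite dotZr dotC dot_suml; congr (_ * _).
by apply: eq_bigr => j _; rewrite dotC dot_kernel_elt.
Qed.

(** This form exhibits a single term of the kernel as an element of the space. *)
Definition wave K y : HW := tail_elt K y - tail_elt K.+1 y.

Lemma waveE K y x : rkhs_fun (wave K y) x = Wterm (y - set_val x) K.
Proof. by rewrite rkhs_funB !tail_eltE W_tailS. Qed.

(** By the reproducing property, pairing with [tail_elt] averages the values of the wave, and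
    [avg_cos] applies. *)
Lemma dot_wave_tail n z K y :
  dot (wave n z) (tail_elt K y) = if (n < K)%N then 0 else Wterm (y - z) n.
Proof.
rewrite dot_tail_elt; under eq_bigr => j _.
  rewrite waveE; have [k ->] := wrap_ptE (y + j%:R * (2 / b%:R ^+ K)).
  rewrite -W_termN opprB (addrAC _ (k%:~R * 2)) W_term_periodic (addrAC y).
  over.
by rewrite /W_term -mulr_sumr mulrCA (avg_cos b2); case: ifP; rewrite ?mulr0.
Qed.

Lemma dot_wave n z m y :
  dot (wave n z) (wave m y) = if n == m then Wterm (y - z) n else 0.
Proof.
rewrite dotBr !dot_wave_tail ltnS.
by case: (ltngtP n m); rewrite ?subrr ?subr0.
Qed.

Definition cos_elt n : HW := (sa ^+ n)^-1 *: wave n 0.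
(** A shift by a quarter period turns the cosine into a sine; the factor normalizes, as the squared
    norm of a wave of index [n] is [a ^ n]. *)
Definition sin_elt n : HW := (sa ^+ n)^-1 *: wave n (2 * b%:R ^+ n)^-1.

Let divsa n t : (sa ^+ n)^-1 * (a ^+ n * t) = sa ^+ n * t.
Proof. by rewrite -saE !mulrA mulVf ?mul1r// gt_eqF. Qed.

Let quarter n : b%:R ^+ n * pi * (2 * b%:R ^+ n)^-1 = pi / 2 :> R.
Proof. by field; rewrite gt_eqF. Qed.

Lemma cos_eltE n x :
  rkhs_fun (cos_elt n) x = sa ^+ n * cos (b%:R ^+ n * pi * set_val x).
Proof. by rewrite rkhs_funZ waveE /W_term divsa sub0r mulrN cosN. Qed.

Lemma sin_eltE n x :
  rkhs_fun (sin_elt n) x = sa ^+ n * sin (b%:R ^+ n * pi * set_val x).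
Proof.
rewrite rkhs_funZ waveE /W_term divsa mulrBr quarter.
by rewrite -[X in cos X]opprB cosN cosBpihalf.
Qed.

Let normalize n t : (sa ^+ n)^-1 * ((sa ^+ n)^-1 * (a ^+ n * t)) = t.
Proof. by rewrite divsa mulKf// gt_eqF. Qed.

Lemma dot_cos_cos n m : dot (cos_elt n) (cos_elt m) = (n == m)%:R.
Proof.
rewrite dotZl dotZr dot_wave; case: eqP => [->|_]; last by rewrite !mulr0.
by rewrite normalize subrr mulr0 cos0.
Qed.

Lemma dot_sin_sin n m : dot (sin_elt n) (sin_elt m) = (n == m)%:R.
Proof.
rewrite dotZl dotZr dot_wave; case: eqP => [->|_]; last by rewrite !mulr0.
by rewrite normalize subrr mulr0 cos0.
Qed.

Lemma dot_cos_sin n m : dot (cos_elt n) (sin_elt m) = 0.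
Proof.
rewrite dotZl dotZr dot_wave; case: eqP => [->|_]; last by rewrite !mulr0.
by rewrite normalize subr0 quarter cos_pihalf.
Qed.

Lemma wave_cos_sin n y : wave n y = sa ^+ n *:
  (cos (b%:R ^+ n * pi * y) *: cos_elt n + sin (b%:R ^+ n * pi * y) *: sin_elt n).
Proof.
apply: rkhs_fun_inj; apply/funext => x.
rewrite waveE rkhs_funZ rkhs_funD rkhs_funZ cos_eltE rkhs_funZ sin_eltE /W_term.
by rewrite mulrBr cosB -saE; ring.
Qed.

Lemma tail_elt_sum K y : tail_elt K y = kernel_elt y - \sum_(n < K) wave n y.
Proof.
elim: K => [|K IH].
  by rewrite /tail_elt big_ord0 subr0 big_ord1 invr1 scale1r mul0r addr0.
by rewrite big_ord_recr /= opprD addrA -IH /wave opprB addrC subrK.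
Qed.

(** By the reproducing property the squared norm is an average of values of the tail, each at most
    its value at 0. *)
Lemma norm_tail_elt K y : `|tail_elt K y| ^+ 2 <= Wtail K 0.
Proof.
rewrite normE dot_tail_elt ler_pdivrMl//.
apply: le_trans (_ : \sum_(j < b ^ K) Wtail K 0 <= _).
  apply: ler_sum => j _; rewrite tail_eltE.
  by apply: le_trans (ler_norm _) _; exact: W_tail_le.
by rewrite sumr_const card_ord -[leLHS]mulr_natl natrX.
Qed.

(** Removing finitely many waves from a kernel section does not change its product with [f], so
    [f x] is the product of [f] with [tail_elt K x] for every [K]; by Cauchy-Schwarz this tends to
    0. *)
Lemma waves_total f :
  (forall n, dot f (cos_elt n) = 0) -> (forall n, dot f (sin_elt n) = 0) -> f = 0.
Proof.
move=> f_cos f_sin; apply: rkhs_fun_inj; apply/funext => x.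
rewrite [RHS]rkhs_funE dot0l rkhs_funE.
have -> : rkhs_kernel HW x = kernel_elt (set_val x).
  by apply: rkhs_fun_inj; apply/funext => y; rewrite rkhs_kernelE kernel_eltE.
have tailE K : dot f (kernel_elt (set_val x)) = dot f (tail_elt K (set_val x)).
  rewrite tail_elt_sum dotBr [X in _ - X]dotC dot_suml big1 ?subr0// => n _.
  rewrite dotC wave_cos_sin dotZr dotDr (dotZr (cos _)) (dotZr (sin _)).
  by rewrite f_cos f_sin !mulr0 addr0 mulr0.
apply/eqP; rewrite -sqrf_eq0 -real_normK ?num_real//; apply/eqP.
apply: le_anti; rewrite sqr_ge0 andbT.
have : (fun K => `|f| ^+ 2 * Wtail K 0) @ \oo --> `|f| ^+ 2 * 0.
  by apply: cvgMl_tmp; exact: W_tail0_cvg0.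
rewrite mulr0.
move/(ler_cvg_to (cvg_cst _)); apply; apply: nearW => K.
rewrite (tailE K); apply: le_trans (_ : (`|f| * `|tail_elt K (set_val x)|) ^+ 2 <= _).
  by rewrite lerXn2r ?nnegrE ?mulr_ge0 ?cauchy_schwarz.
by rewrite exprMn ler_wpM2l ?sqr_ge0 ?norm_tail_elt.
Qed.

Definition combination c d n : HW := c n *: cos_elt n + d n *: sin_elt n.

Lemma combinationE c d n x : rkhs_fun (combination c d n) x =
  a `^ (n%:R / 2) * (c n * cos (b%:R ^+ n * pi * set_val x) +
                     d n * sin (b%:R ^+ n * pi * set_val x)).
Proof.
by rewrite powR_half_nat rkhs_funD rkhs_funZ cos_eltE rkhs_funZ sin_eltE /sa; ring.
Qed.

Lemma has_expansion_cvg c d f : series (combination c d) @ \oo --> f ->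
  has_expansion a b (rkhs_fun f) c d.
Proof.
move=> cf x; apply: cvg_trans (cvg_rkhs_fun _ _ x cf).
apply: near_eq_cvg; apply: nearW => N; rewrite /series /= rkhs_fun_sum.
by apply: eq_bigr => n _; rewrite combinationE.
Qed.

Lemma dot_combination_cos c d n m :
  dot (combination c d n) (cos_elt m) = (n == m)%:R * c n.
Proof.
rewrite dotDl (dotZl (c n)) dot_cos_cos (dotZl (d n)) (dotC (sin_elt _)).
by rewrite dot_cos_sin mulr0 addr0 mulrC.
Qed.

Lemma dot_combination_sin c d n m :
  dot (combination c d n) (sin_elt m) = (n == m)%:R * d n.
Proof.
rewrite dotDl (dotZl (c n)) dot_cos_sin (dotZl (d n)) dot_sin_sin.
by rewrite mulr0 add0r mulrC.
Qed.

Lemma dot_combination c d c' d' n m :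
  dot (combination c d n) (combination c' d' m) = (n == m)%:R * (c n * c' n + d n * d' n).
Proof.
rewrite [combination c' d' m]/combination dotDr (dotZr (c' m)) (dotZr (d' m)).
rewrite dot_combination_cos dot_combination_sin.
by case: eqP => [->|_] /=; ring.
Qed.

Lemma norm_combinations c d N M :
  `|\sum_(N <= n < M) combination c d n| ^+ 2 =
  \sum_(N <= n < M) (c n ^+ 2 + d n ^+ 2).
Proof.
rewrite normE dot_suml; apply: eq_big_nat => n nNM.
rewrite dotC dot_suml (bigD1_seq n) ?iota_uniq ?mem_index_iota//=.
rewrite big1 ?addr0 => [|i /negPf ni]; last by rewrite dot_combination ni mul0r.
by rewrite dot_combination eqxx mul1r !expr2.
Qed.

(** Orthonormality turns the Cauchy criterion in norm into that of the series of squares, and the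
    space is complete. *)
Lemma cvg_combinations c d : square_summable c -> square_summable d ->
  cvg (series (combination c d) @ \oo).
Proof.
move=> c2 d2; apply/cauchy_cvgP/cauchy_seriesP => e e0.
have : cvgn (series (fun n => c n ^+ 2 + d n ^+ 2)).
  by have := is_cvg_seriesD c2 d2.
move=> /cauchy_cvgP/cauchy_seriesP /(_ (e ^+ 2) (exprn_gt0 2 e0)).
apply: filterS => -[N M] /=; rewrite -norm_combinations => h.
rewrite -(@ltr_pXn2r _ 2%N) ?nnegrE ?(ltW e0)//.
exact: le_lt_trans (ler_norm _) h.
Qed.

Lemma dot_series_cos c d f m : series (combination c d) @ \oo --> f ->
  dot f (cos_elt m) = c m.
Proof.
move=> /(cvg_dotl _ _ (cos_elt m)) h; apply: (cvg_unique (@Rhausdorff R) h).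
apply: cvg_near_cst; exists m.+1 => // N mN.
rewrite /series /= dot_suml (bigD1_seq m) ?iota_uniq ?mem_index_iota//=.
rewrite dot_combination_cos eqxx mul1r big1 ?addr0// => i /negPf im.
by rewrite dot_combination_cos im mul0r.
Qed.

Lemma dot_series_sin c d f m : series (combination c d) @ \oo --> f ->
  dot f (sin_elt m) = d m.
Proof.
move=> /(cvg_dotl _ _ (sin_elt m)) h; apply: (cvg_unique (@Rhausdorff R) h).
apply: cvg_near_cst; exists m.+1 => // N mN.
rewrite /series /= dot_suml (bigD1_seq m) ?iota_uniq ?mem_index_iota//=.
rewrite dot_combination_sin eqxx mul1r big1 ?addr0// => i /negPf im.
by rewrite dot_combination_sin im mul0r.
Qed.

Let coef_cos f n := dot f (cos_elt n).
Let coef_sin f n := dot f (sin_elt n).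

Lemma bessel f N :
  \sum_(0 <= n < N) (coef_cos f n ^+ 2 + coef_sin f n ^+ 2) <= `|f| ^+ 2.
Proof.
set P := \sum_(0 <= n < N) combination (coef_cos f) (coef_sin f) n.
have fP : dot P f = \sum_(0 <= n < N) (coef_cos f n ^+ 2 + coef_sin f n ^+ 2).
  rewrite dot_suml; apply: eq_bigr => n _.
  by rewrite dotDl (dotZl (coef_cos f n)) (dotZl (coef_sin f n)) !(dotC _ f) !expr2.
have := dot_ge0 (f - P).
by rewrite dotBr !dotBl (dotC f P) -!normE norm_combinations fP; lra.
Qed.

Lemma coef_square_summable f :
  square_summable (coef_cos f) /\ square_summable (coef_sin f).
Proof.
have : cvgn (series (fun n => coef_cos f n ^+ 2 + coef_sin f n ^+ 2)).
  apply: nondecreasing_is_cvgn.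
    by apply: nondecreasing_series => n _ _; rewrite addr_ge0 ?sqr_ge0.
  by exists (`|f| ^+ 2) => _ [N _ <-]; exact: bessel.
by move=> h; split; apply: series_le_cvg h => n; rewrite ?addr_ge0 ?sqr_ge0//
  ?lerDl ?lerDr ?sqr_ge0.
Qed.

(** By Bessel's inequality the expansion converges to some [F]; [f - F] is orthogonal to all waves,
    hence 0. *)
Lemma cvg_expansion f :
  series (combination (coef_cos f) (coef_sin f)) @ \oo --> f.
Proof.
have [c2 d2] := coef_square_summable f.
have /cvg_ex[/= F PF] := cvg_combinations _ _ c2 d2.
suff fF : f = F by rewrite -fF in PF.
apply/eqP; rewrite -subr_eq0; apply/eqP; apply: waves_total => n.
  by rewrite dotBl (dot_series_cos _ _ _ _ PF) subrr.
by rewrite dotBl (dot_series_sin _ _ _ _ PF) subrr.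
Qed.

End WeierstrassSpace.

(** * Density of the functions satisfying the limit condition *)

Section Density.
Context {R : realType} {a : R} {b : nat}.
Hypotheses (a_gt0 : 0 < a) (a_lt1 : a < 1) (b2 : (2 <= b)%N).
Hypothesis (ab : 1 <= a * b%:R).
Context (HW : rkhs (W a b)).

Let rate : R := a `^ (1 / 2) * b%:R.

Let rate_sqr : rate ^+ 2 = a * b%:R * b%:R.
Proof.
rewrite exprMn -powR_mulrn ?powR_ge0// -powRrM mul1r mulVf// powRr1 ?ltW//.
by rewrite -mulrA -expr2.
Qed.

Let rate_gt0 : 0 < rate.
Proof. by rewrite mulr_gt0 ?powR_gt0// ltr0n; lia. Qed.

Definition slow n : R := rate^-1 ^+ n.

(** The squares are geometric with ratio the inverse of [rate ^+ 2 = a * b * b], which is at least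
    [b >= 2]. *)
Lemma square_summable_slow : square_summable slow.
Proof.
have rs2 : 2 <= rate ^+ 2.
  have : 2 <= b%:R :> R by rewrite ler_nat.
  by move=> hb; rewrite rate_sqr (le_trans hb)// ler_peMl// ler0n.
rewrite /square_summable (_ : (fun n => _) = geometric 1 (rate ^+ 2)^-1).
  apply: is_cvg_geometric_series; rewrite ger0_norm ?invr_ge0 ?sqr_ge0//.
  by rewrite invf_lt1 (lt_le_trans _ rs2)// ltr1n.
by apply/funext => n; rewrite /= mul1r /slow -exprM mulnC exprM exprVn.
Qed.

Definition splice N (c : R^nat) : R^nat := fun n => if (n < N)%N then c n else slow n.

Lemma square_summable_splice N c : square_summable c -> square_summable (splice N c).
Proof.
move=> c2; have := is_cvg_seriesD c2 square_summable_slow.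
apply: series_le_cvg => n /=; rewrite ?addr_ge0 ?sqr_ge0//.
by rewrite /splice; case: ifP; rewrite ?lerDl ?lerDr sqr_ge0.
Qed.

Lemma nonzero_limit_splice N c : nonzero_limit (fun n => splice N c n * rate ^+ n).
Proof.
exists 1%E; first exact: oner_neq0.
apply: cvg_near_cst; exists N => // n /= Nn.
by rewrite /splice ltnNge Nn /= -exprMn mulVf ?expr1n// gt_eqF.
Qed.

Lemma splice_dense (f : HW) (e : R) : 0 < e -> exists (h : HW) (c d : R^nat),
  `|f - h| < e /\
  [/\ square_summable c, square_summable d, has_expansion a b (rkhs_fun h) c d &
      nonzero_limits a b c d].
Proof.
move=> e0.
have [c2 d2] := coef_square_summable a_gt0 a_lt1 b2 HW f.
have Pf := cvg_expansion a_gt0 a_lt1 b2 HW f.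
set c := (fun n => dot f (cos_elt HW n)) in c2 Pf.
set d := (fun n => dot f (sin_elt HW n)) in d2 Pf.
have s2 := square_summable_slow.
have /cvg_ex[/= T PT] := cvg_combinations a_gt0 a_lt1 b2 HW _ _ s2 s2.
have eh : 0 < e / 2 by rewrite divr_gt0.
move/cvgr_dist_lt : Pf => /(_ _ eh) [N1 _ HN1].
have [N2 _ HN2] : \forall n \near \oo,
    `|T - series (combination HW slow slow) n| < e / 2.
  by move/cvgr_dist_lt : PT; exact.
pose N := maxn N1 N2.
pose P := series (combination HW c d) N.
pose Q := series (combination HW slow slow) N.
(* [T - Q] is the tail of the series [T] with coefficients [slow]. So [f - h] is the tail [f - P]
   minus the tail [T - Q], each of norm below [e / 2]. *)
exists (P + (T - Q)), (splice N c), (splice N d); split.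
  rewrite opprD addrA (le_lt_trans (ler_normB _ _))// [e]splitr ltrD//.
    by apply: HN1; exact: leq_maxl.
  by apply: HN2; exact: leq_maxr.
split; [exact: square_summable_splice..| |].
  apply: has_expansion_cvg => //.
  have h : (fun M => P + (series (combination HW slow slow) M - Q)) @ \oo --> P + (T - Q).
    by apply: cvgD; [exact: cvg_cst|apply: cvgB; [exact: PT|exact: cvg_cst]].
  apply: cvg_trans h; apply: near_eq_cvg; exists N => // M /= NM.
  rewrite /P /Q /series /= !(@big_cat_nat _ _ _ N 0 M)//= addrAC subrr add0r.
  congr (_ + _); apply: eq_big_nat => n.
    by move=> /andP[_ nN]; rewrite /combination /splice nN.
  by move=> /andP[Nn _]; rewrite /combination /splice ltnNge Nn.
by split; exact: nonzero_limit_splice.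
Qed.

End Density.

Theorem theorem3p3 (R : realType) (a : R) (b : int)
    (ha : 0 < a < 1) (hab : 1 <= a * b%:~R) (HW : rkhs (W a b)) :
  (forall (f : HW) (c d : R^nat),
      square_summable c -> square_summable d ->
      has_expansion a b (rkhs_fun f) c d -> nonzero_limits a b c d ->
      nowhere_differentiable (rkhs_fun f)) /\
  closure [set f : HW | exists c d : R^nat,
      [/\ square_summable c, square_summable d,
          has_expansion a b (rkhs_fun f) c d & nonzero_limits a b c d]]
    = [set: HW].
Proof.
case/andP: ha => a0 a1.
(* If [b <= 1] then [a * b <= a < 1]. Hence [b] is a natural number, at least 2. *)
have b1 : 1 < b%:~R :> R by rewrite ltNge; apply/negP => b1; nra.
case: b => b in hab HW b1 *; last first.
  by exfalso; move: b1; rewrite NegzE ltNge (le_trans _ ler01)// mulrNz oppr_le0.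
have b2 : (2 <= b)%N by rewrite -(ltr_nat R).
split=> [f c d _ _|].
  exact: nonzero_limits_nowhere_differentiable.
apply/seteqP; split=> // f _ B /nbhs_ballP[e /= e0 eB].
have [h [c [d [fh H]]]] := splice_dense a0 a1 b2 hab HW f e e0.
exists h; split; first by exists c, d.
by apply: eB; rewrite -ball_normE.
Qed.
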